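(* Let $\mathcal{H}$ be a finite graph with no induced $4$-cycle. Then $\mathcal{H}$ is a shortest path graph if and only if $\mathcal{H}$ is a collection of cliques that has no induced cycle $C_k$ for every odd $k\geq 5$. Furthermore, in that case there exist a graph $G$ and vertices $a,b\in V(G)$ with $d_G(a,b)=3$ (i.e., $(a,b)$-geodesics have exactly two index levels) such that $S(G,a,b)\cong\mathcal{H}$.
   Context: All graphs are simple and finite. For a graph $G$ and distinct $a,b\in V(G)$, an $(a,b)$-geodesic is a shortest path from $a$ to $b$ in $G$. The shortest path graph $S(G,a,b)$ has as vertices the $(a,b)$-geodesics of $G$, two being adjacent iff their vertex sets differ in exactly one vertex. A graph $\mathcal{H}$ is a shortest path graph (SPG) if $\mathcal{H}\cong S(G,a,b)$ for some graph $G$ and distinct $a,b\in V(G)$. If $d_G(a,b)=n+1$, geodesics have the form $av_1\cdots v_nb$ and are said to have $n$ index levels; $v_i$ is at index level $i$. A graph is $H$-free if it has no induced subgraph isomorphic to $H$. A maximal clique is a clique not contained in a larger clique. A collection of cliques is a graph that is claw-free ($K_{1,3}$-free) and in which any two distinct maximal cliques share at most one vertex. *)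

(* Defs.v *)
From mathcomp Require Import all_boot.

Set Implicit Arguments.
Unset Strict Implicit.
Unset Printing Implicit Defensive.

Record sgraph := SGraph {
  vertex :> finType;
  adj : rel vertex;
  adj_sym : symmetric adj;
  adj_irr : irreflexive adj
}.

Definition isomorphic (F G : sgraph) : Prop :=
  exists f : F -> G, bijective f /\ forall x y, adj (f x) (f y) = adj x y.

Definition induced_subgraph (F G : sgraph) : Prop :=
  exists f : F -> G, injective f /\ forall x y, adj (f x) (f y) = adj x y.

Definition is_free (F G : sgraph) : Prop := ~ induced_subgraph F G.

(* K_{1,3}, with centre [ord0]. *)
Definition claw_rel : rel 'I_4 := fun x y => (x == ord0) != (y == ord0).

Lemma claw_rel_sym : symmetric claw_rel.
Proof. by move=> x y; rewrite /claw_rel eq_sym. Qed.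

Lemma claw_rel_irr : irreflexive claw_rel.
Proof. by move=> x; rewrite /claw_rel eqxx. Qed.

Definition claw : sgraph := SGraph claw_rel_sym claw_rel_irr.

(* C_k for k >= 3; [ordS] is the successor modulo k.  The conjunct [x != y]
   only matters for the degenerate value k = 1. *)
Definition cycle_rel k : rel 'I_k :=
  fun x y => (x != y) && ((y == ordS x) || (x == ordS y)).

Lemma cycle_rel_sym k : symmetric (@cycle_rel k).
Proof. by move=> x y; rewrite /cycle_rel eq_sym orbC. Qed.

Lemma cycle_rel_irr k : irreflexive (@cycle_rel k).
Proof. by move=> x; rewrite /cycle_rel eqxx. Qed.

Definition cycle_graph k : sgraph :=
  SGraph (@cycle_rel_sym k) (@cycle_rel_irr k).

Definition clique (G : sgraph) (A : {set G}) : bool :=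
  [forall x in A, forall y in A, (x != y) ==> adj x y].

Definition maximal_clique (G : sgraph) (A : {set G}) : bool :=
  maxset (@clique G) A.

Definition collection_of_cliques (G : sgraph) : Prop :=
  is_free claw G /\
  forall A B : {set G},
    maximal_clique A -> maximal_clique B -> A <> B -> #|A :&: B| <= 1.

Section ShortestPaths.

Variables (G : sgraph) (a b : G).

(* A path is given by the list of all its vertices, both ends included, so its
   length is [(size s).-1]. *)
Definition is_path (s : seq G) : bool :=
  if s is x :: p then [&& x == a, last x p == b, path (@adj G) x p & uniq s]
  else false.

(* Paths have no repeated vertex, hence at most [#|G|] vertices: comparing with
   the lists in the finite type [#|G|.-bseq G] is comparing with all paths (see
   [geodesicP]). *)
Definition geodesic (s : seq G) : bool :=
  is_path s && [forall t : #|G|.-bseq G, is_path t ==> (size s <= size t)].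

Lemma size_is_path s : is_path s -> size s <= #|G|.
Proof.
case: s => // x p /and4P[_ _ _ /card_uniqP <-]; exact: max_card.
Qed.

Lemma geodesicP s :
  reflect (is_path s /\ forall t, is_path t -> size s <= size t) (geodesic s).
Proof.
apply: (iffP andP) => -[ps min_s]; split=> //.
  move=> t pt; have /forallP/(_ (Bseq (size_is_path pt))) := min_s.
  by rewrite pt.
by apply/forallP=> t; apply/implyP; apply: min_s.
Qed.

(* [None] is the infinite distance. *)
Definition dist : option nat :=
  omap (fun t : #|G|.-bseq G => (size t).-1)
       [pick t : #|G|.-bseq G | geodesic t].

Lemma distP d :
  dist = Some d <-> exists2 s, geodesic s & size s = d.+1.
Proof.
rewrite /dist; split=> [|[s gs sz_s]].
  case: pickP => //= t gt [<-]; exists t => //.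
  by have /geodesicP[] := gt; case: (bseqval t).
have /geodesicP[ps min_s] := gs.
case: pickP => [t gt|/(_ (Bseq (size_is_path ps)))] /=; last by rewrite gs.
have /geodesicP[pt min_t] := gt.
have -> // : size t = d.+1 by apply/eqP; rewrite -sz_s eqn_leq min_t // min_s.
Qed.

Definition geodesic_type : finType := {s : #|G|.-bseq G | geodesic s}.

Definition vset (s : geodesic_type) : {set G} := [set x in bseqval (val s)].

Definition geodesic_rel : rel geodesic_type :=
  fun s t => (#|vset s :\: vset t| == 1) && (#|vset t :\: vset s| == 1).

Lemma geodesic_rel_sym : symmetric geodesic_rel.
Proof. by move=> s t; rewrite /geodesic_rel andbC. Qed.

Lemma geodesic_rel_irr : irreflexive geodesic_rel.
Proof. by move=> s; rewrite /geodesic_rel setDv cards0. Qed.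

Definition shortest_path_graph : sgraph :=
  SGraph geodesic_rel_sym geodesic_rel_irr.

End ShortestPaths.

Definition is_SPG (H : sgraph) : Prop :=
  exists (G : sgraph) (a b : G), a != b /\ isomorphic H (shortest_path_graph a b).

(* Main.v *)
(* A geodesic with n index levels is a point of an n-dimensional grid, and each
   edge of S(G,a,b) is labelled by the one level at which its ends differ.
   Changes at levels that are not consecutive can be made independently and
   span an induced 4-cycle; hence, without such cycles, the two edges of an
   induced path on three vertices have consecutive labels, of opposite parity.
   A claw would need three pairwise opposite parities, and parities alternate
   along an induced cycle of length at least 5, which is thus even.  All edges
   of a triangle have the same label, so there is no diamond either.

   Conversely, in a collection of cliques each vertex lies in at most two
   maximal cliques.  An odd cycle of pairwise distinct, successively meeting
   maximal cliques would give an odd hole, or a triangle when there are three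
   of them; so the maximal cliques can be 2-coloured with meeting cliques in
   different colours.  Sending a vertex to its cliques of the first and of the
   second colour realizes the graph as geodesics a v1 v2 b. *)

Require Import Defs.
From mathcomp Require Import all_boot.
Set Implicit Arguments.
Unset Strict Implicit.
Unset Printing Implicit Defensive.

(** * Isomorphisms, and induced claws and 4-cycles from explicit vertices *)

Lemma isomorphic_sym (F G : sgraph) : isomorphic F G -> isomorphic G F.
Proof.
case=> f [[g fK gK] f_adj]; exists g; split; first by exists f.
by move=> x y; rewrite -f_adj !gK.
Qed.

Lemma claw_induced (G : sgraph) (x y1 y2 y3 : G) :
    adj x y1 -> adj x y2 -> adj x y3 -> y1 <> y2 -> y1 <> y3 -> y2 <> y3 ->
    ~~ adj y1 y2 -> ~~ adj y1 y3 -> ~~ adj y2 y3 ->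
  induced_subgraph claw G.
Proof.
move=> a1 a2 a3 n12 n13 n23 /negPf m12 /negPf m13 /negPf m23.
have nadj (u v : G) : adj u v -> u <> v by move=> + euv; rewrite euv adj_irr.
have := (nadj _ _ a1, nadj _ _ a2, nadj _ _ a3); move=> [[n1 n2] n3].
exists (fun i : 'I_4 => nth x [:: x; y1; y2; y3] i); split.
  move=> [[|[|[|[|//]]]] lti] [[|[|[|[|//]]]] ltj] /= eij;
    by [apply: val_inj | case: (nesym eij) | congruence].
move=> [[|[|[|[|//]]]] lti] [[|[|[|[|//]]]] ltj];
  by rewrite /= /claw_rel -!val_eqE /= ?adj_irr ?m12 ?m13 ?m23 //
     adj_sym // ?m12 ?m13 ?m23.
Qed.

Lemma C4_induced (G : sgraph) (x y z w : G) :
    adj x y -> adj y z -> adj z w -> adj w x -> x <> z -> y <> w ->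
    ~~ adj x z -> ~~ adj y w ->
  induced_subgraph (cycle_graph 4) G.
Proof.
move=> axy ayz azw awx nxz nyw /negPf mxz /negPf myw.
have nadj (u v : G) : adj u v -> u <> v by move=> + euv; rewrite euv adj_irr.
have := (nadj _ _ axy, nadj _ _ ayz, nadj _ _ azw, nadj _ _ awx).
move=> [[[nxy nyz] nzw] nwx].
exists (fun i : 'I_4 => nth x [:: x; y; z; w] i); split.
  move=> [[|[|[|[|//]]]] lti] [[|[|[|[|//]]]] ltj] /= eij;
    by [apply: val_inj | congruence].
move=> [[|[|[|[|//]]]] lti] [[|[|[|[|//]]]] ltj];
  by rewrite /= /cycle_rel -!val_eqE /= ?adj_irr ?mxz ?myw //
     adj_sym // ?mxz ?myw.
Qed.

(** * Geodesics as points of a grid *)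

Section Geodesics.

Variables (G : sgraph) (a b : G).
Implicit Types s t : seq G.

(** Repetitions are allowed, so that pieces of geodesics can be spliced freely; minimality restores
    [uniq] afterwards. *)
Definition walk s : bool :=
  if s is x :: p then [&& x == a, last x p == b & path (@adj G) x p] else false.

Lemma walkP s :
  reflect [/\ 0 < size s, nth a s 0 = a, nth a s (size s).-1 = b
            & forall i, i.+1 < size s -> adj (nth a s i) (nth a s i.+1)]
          (walk s).
Proof.
case: s => [|x p]; first by apply: ReflectF => -[].
apply: (iffP and3P) => [[/eqP xa /eqP pb /(pathP a) xp]|[_ /= xa pb xp]].
  by split=> //; rewrite nth_last.
by split; [apply/eqP | rewrite -pb -(last_nth a) | apply/(pathP a)].
Qed.

Lemma is_pathE s : is_path a b s = walk s && uniq s.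
Proof. by case: s => //= x p; rewrite -!andbA. Qed.

Lemma is_path_walk s : is_path a b s -> walk s.
Proof. by rewrite is_pathE => /andP[]. Qed.

Lemma geodesic_walk s : geodesic a b s -> walk s.
Proof. by case/geodesicP => /is_path_walk. Qed.

Lemma geodesic_leq_walk s t : geodesic a b s -> walk t -> size s <= size t.
Proof.
case/geodesicP=> _ min_s; case: t => // x p /= /and3P[xa + xp].
case/shortenP: xp => q xq uxq sub_qp qb.
have := min_s (x :: q); rewrite /is_path xa qb xq uxq => /(_ isT) /leq_trans.
apply.
by rewrite ltnS; apply: uniq_leq_size => //; case/andP: uxq.
Qed.

Lemma geodesic_size s t : geodesic a b s -> geodesic a b t -> size s = size t.
Proof.
move=> gs gt; apply/eqP.
by rewrite eqn_leq !geodesic_leq_walk ?geodesic_walk.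
Qed.

(** Removing the loops of [t] leaves a path on some of its vertices, and this path is at least as
    long as [s], hence as [t]. So [t] had no repetition. *)
Lemma walk_geodesic s t :
  geodesic a b s -> walk t -> size t = size s -> geodesic a b t.
Proof.
move=> gs wt sz_t; apply/geodesicP; split; last first.
  by move=> r /is_path_walk wr; rewrite sz_t geodesic_leq_walk.
case: t wt sz_t => // x p /= /and3P[xa pb xp] sz_p; rewrite xa pb xp /=.
have: size s <= (size p).+1 by rewrite sz_p.
case/geodesicP: gs => _ min_s _; move: pb.
case/shortenP: (xp) => q xq uxq sub_qp qb.
have := min_s (x :: q); rewrite /is_path xa qb xq uxq -sz_p => /(_ isT) le_pq.
apply: (@leq_size_uniq _ (x :: q) (x :: p)) => // y.
by rewrite !inE => /orP[-> //|/sub_qp->]; rewrite orbT.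
Qed.

(** Following [s] up to the common vertex and [t] from there on is a walk; if [i < j] it would be
    shorter than [t]. *)
Lemma geodesic_level_leq s t i j :
    geodesic a b s -> geodesic a b t -> i < size s -> j < size t ->
  nth a s i = nth a t j -> j <= i.
Proof.
move=> gs gt lti ltj eij.
have: size t <= size (take i s ++ drop j t); last first.
  rewrite size_cat size_take size_drop lti.
  by rewrite -{1}(subnK (ltnW ltj)) addnC leq_add2r.
apply: geodesic_leq_walk => //.
have := geodesic_walk gs; have := geodesic_walk gt.
rewrite -{1}(cat_take_drop j t) -{1}(cat_take_drop i s).
rewrite (drop_nth a lti) (drop_nth a ltj) -eij.
case: (take i s) => [|x s1]; case: (take j t) => [|y t1] //=.
- rewrite !last_cat !cat_path /= => /and3P[_ tb /and3P[_ _ tp]] /and3P[-> _ _].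
  by rewrite tb tp.
- rewrite !last_cat !cat_path /= => /and3P[_ tb tp] /and3P[-> _].
  by case/and3P=> -> -> _; rewrite tb tp.
rewrite !last_cat !cat_path /= => /and3P[_ tb /and3P[_ _ tp]] /and3P[-> _].
by case/and3P=> -> -> _; rewrite tb tp.
Qed.

Lemma geodesic_level s t i j :
    geodesic a b s -> geodesic a b t -> i < size s -> j < size t ->
  nth a s i = nth a t j -> i = j.
Proof.
move=> gs gt lti ltj eij; apply/eqP; rewrite eqn_leq.
rewrite (geodesic_level_leq gs gt lti ltj eij) andbT.
exact: geodesic_level_leq gt gs ltj lti (esym eij).
Qed.

End Geodesics.

Definition differ_at (T : Type) (u v : nat -> T) (i : nat) : Prop :=
  u i <> v i /\ forall j : nat, j != i -> u j = v j.

Section DifferAt.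

Variable T : Type.
Implicit Types u v w : nat -> T.

Lemma differ_at_sym u v i : differ_at u v i -> differ_at v u i.
Proof. by case=> uvi uvj; split=> [/esym//|j /uvj]. Qed.

Lemma differ_at_uniq u v i j : differ_at u v i -> differ_at u v j -> i = j.
Proof.
by move=> [uvi _] [_ uvj]; apply/eqP; apply: contra_notT uvi => /uvj.
Qed.

Lemma differ_at_triangle u v w i j k :
  differ_at u v i -> differ_at u w j -> differ_at v w k -> i = j.
Proof.
move=> uv uw vw; apply/eqP/negPn/negP=> nij.
have kj : k = j.
  apply/eqP; rewrite eq_sym; apply: contra_notT uw.1 => nkj.
  by rewrite uv.2 1?eq_sym // vw.2.
by apply: uv.1; rewrite uw.2 // vw.2 // kj.
Qed.

End DifferAt.

(** * Adjacency of geodesics in terms of coordinates *)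

Section Coordinates.

Variables (G : sgraph) (a b : G).
Local Notation S := (shortest_path_graph a b).

(** Beyond the end the value is [a]. All geodesics have the same size, so this padding never tells
    two of them apart, and no bound on the index is needed. *)
Definition coord (x : S) : nat -> G := nth a (bseqval (val x)).

Lemma coord_inj (x y : S) : coord x =1 coord y -> x = y.
Proof.
move=> exy; do 2!apply: val_inj; apply: (@eq_from_nth _ a) => [|i _].
  exact: geodesic_size (valP x) (valP y).
exact: exy.
Qed.

Lemma mem_coord (x : S) i :
  i < size (val x) -> coord x i \in bseqval (val x).
Proof. exact: mem_nth. Qed.

Lemma coord_default (x y : S) i :
  ~~ (i < size (val x)) -> coord x i = coord y i.
Proof.
rewrite -leqNgt => le_xi; rewrite /coord !nth_default //.
by rewrite (geodesic_size (valP y) (valP x)).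
Qed.

Lemma differ_at_vsetD (x y : S) i :
  differ_at (coord x) (coord y) i -> vset x :\: vset y = [set coord x i].
Proof.
move=> [nxyi xyj]; have szxy := geodesic_size (valP x) (valP y).
have lti : i < size (val x) by apply: contra_notT nxyi; apply: coord_default.
apply/setP=> v; rewrite !inE; apply/andP/eqP=> [[vNy /(nthP a)[j ltj xj]]|->].
  rewrite -xj; have [->//|nij] := eqVneq j i; case/negP: vNy.
  by rewrite -xj [nth _ _ _]xyj // mem_coord -?szxy.
split; last exact: mem_coord.
apply/(nthP a)=> -[j ltj ji].
have eji := geodesic_level (valP y) (valP x) ltj lti ji.
by apply: nxyi; rewrite -[LHS]ji eji.
Qed.

(** A vertex occupies the same index in all geodesics through it, so comparing vertex sets amounts
    to comparing coordinates. *)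
Lemma shortest_path_adjP (x y : S) :
  adj x y <-> exists i, differ_at (coord x) (coord y) i.
Proof.
have szxy := geodesic_size (valP x) (valP y).
split=> [/andP[/cards1P[v Dv] _]|[i xyi]]; last first.
  rewrite /= /geodesic_rel (differ_at_vsetD xyi).
  by rewrite (differ_at_vsetD (differ_at_sym xyi)) !cards1.
have: v \in vset x :\: vset y by rewrite Dv set11.
rewrite !inE => /andP[vNy /(nthP a)[i lti xi]].
exists i; split=> [exy|j nji].
  by case/negP: vNy; rewrite -xi [nth _ _ _]exy mem_coord // -szxy.
have [ltj|/coord_default//] := boolP (j < size (val x)).
have [/(nthP a)[l ltl yl]|xjNy] := boolP (coord x j \in bseqval (val y)).
  by rewrite -{1}yl (geodesic_level (valP y) (valP x) ltl ltj yl).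
have : coord x j \in vset x :\: vset y by rewrite !inE xjNy mem_coord.
rewrite Dv inE -xi => /eqP /(geodesic_level (valP x) (valP x) ltj lti) eji.
by rewrite eji eqxx in nji.
Qed.

(* Indices at distance at least two can be changed independently. *)
Lemma coord_mix (x y z : S) i j :
    differ_at (coord y) (coord x) i -> differ_at (coord y) (coord z) j ->
    i != j -> i != j.+1 -> j != i.+1 ->
  exists w : S, forall k, coord w k = if k == j then coord z k else coord x k.
Proof.
move=> yx yz nij nij1 nji1.
have szxz := geodesic_size (valP x) (valP z).
have ltj : j < size (val x).
  apply: contra_notT yz.1 => gej.
  by rewrite -(coord_default z gej) (coord_default y gej).
pose w := set_nth a (val x) j (coord z j).
have wE k : nth a w k = if k == j then coord z k else coord x k.
  by rewrite nth_set_nth /=; case: eqP => [->|].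
have szw : size w = size (val x) by rewrite size_set_nth; apply/maxn_idPr.
have xz k : k != i -> k != j -> coord x k = coord z k.
  by move=> ki kj; rewrite -yx.2 // yz.2.
have /walkP[x_gt0 x0 xn x_adj] := geodesic_walk (valP x).
have /walkP[_ z0 zn z_adj] := geodesic_walk (valP z).
have gw : geodesic a b w.
  apply: (walk_geodesic (valP x) _ szw); apply/walkP; rewrite szw.
  split=> //; rewrite ?wE; try by case: ifP => // _; rewrite /coord ?z0 ?szxz.
  (* Only the edges at [j] are new. The indices next to [j] differ from [i] and [j], so [x] and [z]
     agree there and these edges are edges of [z]. *)
  move=> k ltk; rewrite !wE.
  have zk : adj (coord z k) (coord z k.+1) by apply: z_adj; rewrite -szxz.
  have [kj|nkj] := eqVneq k j; have [k1j|nk1j] := eqVneq k.+1 j => //.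
  - by rewrite xz // kj eq_sym.
  - by rewrite xz //; apply: contra_neq nji1 => <-.
  - exact: x_adj.
have szwG : size w <= #|G| by rewrite szw size_bseq.
by exists (exist (fun s : #|G|.-bseq G => geodesic a b s) (Bseq szwG) gw : S).
Qed.

End Coordinates.

(** * Shortest path graphs without induced 4-cycles *)

Lemma cliqueP (G : sgraph) (A : {set G}) :
  reflect {in A &, forall x y, x != y -> adj x y} (clique A).
Proof.
apply: (iffP forall_inP) => [cA x y xA yA|cA x xA].
  by have /forall_inP/(_ y yA)/implyP := cA x xA.
by apply/forall_inP=> y yA; apply/implyP; apply: cA.
Qed.

Lemma maximal_clique_eq (G : sgraph) (A B : {set G}) :
  maximal_clique A -> maximal_clique B -> clique (A :|: B) -> A = B.
Proof.
case/maxsetP=> _ maxA /maxsetP[_ maxB] cAB.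
by rewrite -(maxA _ cAB) ?subsetUl // (maxB _ cAB) ?subsetUr.
Qed.

(** If [A] and [B] share [u] and [v], a vertex of [A] and one of [B] have [u] and [v] as common
    neighbours, so they are adjacent. Thus the union is a clique, and maximality gives [A = B]. *)
Lemma diamond_free_maximal_cliques (G : sgraph) :
    (forall u v x y : G, adj u v -> adj u x -> adj v x -> adj u y -> adj v y ->
       x <> y -> adj x y) ->
  forall A B : {set G},
    maximal_clique A -> maximal_clique B -> A <> B -> #|A :&: B| <= 1.
Proof.
move=> no_diamond A B mA mB nAB; rewrite leqNgt; apply: contra_notN nAB.
case/card_gt1P=> u [v]; rewrite !inE => -[/andP[uA uB] /andP[vA vB] nuv].
apply: maximal_clique_eq => //.
have /cliqueP cA := maxsetp mA; have /cliqueP cB := maxsetp mB.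
have adjAB x y : x \in A -> y \in B -> x != y -> adj x y.
  move=> xA yB nxy.
  have [ux|nux] := eqVneq u x; first by rewrite cB // -ux.
  have [vx|nvx] := eqVneq v x; first by rewrite cB // -vx.
  have [uy|nuy] := eqVneq u y; first by rewrite cA // -uy.
  have [vy|nvy] := eqVneq v y; first by rewrite cA // -vy.
  apply: (no_diamond u v); try by apply: cA.
  - exact: cB.
  - exact: cB.
  - exact/eqP.
apply/cliqueP=> x y; rewrite !inE => /orP[xA|xB] /orP[yA|yB] nxy.
- exact: cA.
- exact: adjAB.
- by rewrite adj_sym adjAB // eq_sym.
- exact: cB.
Qed.

Section InducedC4Free.

Variables (H G : sgraph) (a b : G) (f : H -> shortest_path_graph a b).
Hypothesis f_bij : bijective f.
Hypothesis f_adj : forall x y, adj (f x) (f y) = adj x y.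
Hypothesis C4_free : is_free (cycle_graph 4) H.

Local Notation "x ~[ i ]~ y" := (differ_at (coord (f x)) (coord (f y)) i)
  (at level 70).

Lemma adj_differ x y : adj x y <-> exists i, x ~[i]~ y.
Proof. by rewrite -f_adj; apply: shortest_path_adjP. Qed.

Lemma coord_eq x y : coord (f x) =1 coord (f y) -> x = y.
Proof. by move/coord_inj/(bij_inj f_bij). Qed.

Lemma label_parity x y z i j :
  y ~[i]~ x -> y ~[j]~ z -> x <> z -> ~~ adj x z -> odd i != odd j.
Proof.
move=> yx yz nxz Nxz.
have nij : i != j.
  apply: contraNneq Nxz => ij; apply/adj_differ; exists i.
  have xz k : k != i -> coord (f x) k = coord (f z) k.
    by move=> ki; rewrite -yx.2 // yz.2 -?ij.
  split=> // xzi; apply: nxz; apply: coord_eq => k.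
  by have [->//|/xz] := eqVneq k i.
apply/negP=> /eqP oij; apply: C4_free.
have nij1 : i != j.+1.
  by apply: contra_eqN oij => /eqP->; rewrite /=; case: odd.
have nji1 : j != i.+1.
  by apply: contra_eqN oij => /eqP->; rewrite /=; case: odd.
(* Making both changes at once gives [w], the corner opposite [y] of an induced 4-cycle. *)
have [fw fwE] := coord_mix yx yz nij nij1 nji1.
have [f' _ f'K] := f_bij; pose w := f' fw.
have wE k : coord (f w) k = if k == j then coord (f z) k else coord (f x) k.
  by rewrite /w f'K.
have nji : j != i by rewrite eq_sym.
have wi : coord (f w) i = coord (f x) i by rewrite wE (negPf nij).
have wj : coord (f w) j = coord (f z) j by rewrite wE eqxx.
apply: (@C4_induced _ x y z w) => //.
- by apply/adj_differ; exists i; apply: differ_at_sym.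
- by apply/adj_differ; exists j.
- apply/adj_differ; exists i; split; first by rewrite wi -yz.2 //; apply: yx.1.
  by move=> k ki; rewrite wE; have [//|kj] := eqVneq k j; rewrite -yx.2 // yz.2.
- apply/adj_differ; exists j; split; last by move=> k /negPf kj; rewrite wE kj.
  by rewrite wj -yx.2 //; apply: nesym; apply: yz.1.
- by move=> yw; apply: yx.1; rewrite yw wi.
apply/negP=> /adj_differ[k yw].
have [ik|nik] := eqVneq i k; last by apply: yx.1; rewrite yw.2 // wi.
by apply: yz.1; rewrite yw.2 -?wj // -ik.
Qed.

Lemma SPG_claw_free : is_free claw H.
Proof.
case=> g [g_inj g_adj].
pose l (i : nat) : claw := inord i.
have lv i : i < 4 -> val (l i) = i by exact: inordK.
have adj_l i j : i < 4 -> j < 4 ->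
    adj (g (l i)) (g (l j)) = ((i == 0) != (j == 0)).
  by move=> lti ltj; rewrite g_adj /= /claw_rel -!val_eqE /= !lv.
have lab i : 0 < i < 4 -> exists k, g (l 0) ~[k]~ g (l i).
  case/andP=> i_gt0 lti; apply/adj_differ.
  by rewrite adj_l // eqxx; case: i i_gt0 lti.
have par i j ki kj : 0 < i < 4 -> 0 < j < 4 -> i != j ->
    g (l 0) ~[ki]~ g (l i) -> g (l 0) ~[kj]~ g (l j) -> odd ki != odd kj.
  move=> /andP[i_gt0 lti] /andP[j_gt0 ltj] nij gi gj.
  apply: (label_parity gi gj).
    by move/g_inj/(congr1 val); rewrite !lv //; apply/eqP.
  by rewrite adj_l //; case: i j i_gt0 j_gt0 {lti ltj nij gi gj} => [|?] [|?].
have [[k1 g1] [k2 g2] [k3 g3]] := And3 (lab 1 isT) (lab 2 isT) (lab 3 isT).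
have := par 1 2 _ _ isT isT isT g1 g2; have := par 1 3 _ _ isT isT isT g1 g3.
have := par 2 3 _ _ isT isT isT g2 g3.
by case: (odd k1) (odd k2) (odd k3) => [] [] [].
Qed.

Lemma SPG_diamond_free (u v x y : H) :
  adj u v -> adj u x -> adj v x -> adj u y -> adj v y -> x <> y -> adj x y.
Proof.
move=> /adj_differ[i uv] /adj_differ[j ux] /adj_differ[k vx].
move=> /adj_differ[l uy] /adj_differ[m vy] nxy.
have ij := differ_at_triangle uv ux vx; have il := differ_at_triangle uv uy vy.
subst j l; apply: contraT => /(label_parity ux uy nxy).
by rewrite eqxx.
Qed.

Lemma SPG_odd_hole_free k : odd k -> 5 <= k -> is_free (cycle_graph k) H.
Proof.
case: k => // k odd_k ge_k [g [g_inj g_adj]].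
(* The hole is extended periodically to all of [nat], so that labels can be followed by
   induction. *)
pose h m := g (inord (m %% k.+1) : 'I_k.+1).
have inv m : val (inord (m %% k.+1) : 'I_k.+1) = m %% k.+1.
  by rewrite /= inordK // ltn_mod.
(* Shifts by 1, 2 and 3 are nonzero modulo the length; the shift by 3 is what keeps [h m] and
   [h m.+2] non-adjacent. *)
have modD d m : 0 < d < 5 -> (m + d == m %[mod k.+1]) = false.
  case/andP=> d_gt0 lt_d5; rewrite -{2}[m]addn0 eqn_modDl mod0n modn_small.
    by rewrite eqn0Ngt d_gt0.
  exact: leq_trans lt_d5 ge_k.
have modS m : ((m.+1 == m %[mod k.+1]) = false)
            * ((m.+2 == m %[mod k.+1]) = false)
            * ((m.+3 == m %[mod k.+1]) = false).
  by rewrite -{1}[m.+3]addn3 -{1}[m.+2]addn2 -{1}[m.+1]addn1 !modD.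
have h_adj m n : adj (h m) (h n) = (m != n %[mod k.+1]) &&
    ((n == m.+1 %[mod k.+1]) || (m == n.+1 %[mod k.+1])).
  rewrite g_adj /= /cycle_rel -!val_eqE /= !inv.
  by rewrite -!(addn1 (_ %% _)) !modnDml !addn1.
have h_adjS m : adj (h m) (h m.+1) by rewrite h_adj eqxx eq_sym modS.
have h_adjSS m : ~~ adj (h m) (h m.+2).
  by rewrite h_adj modS [_ == m.+3 %% _]eq_sym modS andbF.
have h_nSS m : h m <> h m.+2.
  by move/g_inj/(congr1 val); rewrite !inv => /esym/eqP; rewrite modS.
have [l0 hl0] := (adj_differ _ _).1 (h_adjS 0).
have lab m : exists2 l, h m ~[l]~ h m.+1 & odd l = odd m (+) odd l0.
  elim: m => [|m [l hl odd_l]]; first by exists l0.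
  have [l' hl'] := (adj_differ _ _).1 (h_adjS m.+1); exists l' => //=.
  have := label_parity (differ_at_sym hl) hl' (h_nSS m) (h_adjSS m).
  by rewrite odd_l addNb; case: (_ (+) _) (odd l') => [] [].
(* After one full turn the edge is the initial one again, but an odd number of steps has flipped the
   parity of its label. *)
have [l] := lab k.+1.
have -> : h k.+1 = h 0 by rewrite /h modnn mod0n.
have -> : h k.+2 = h 1 by rewrite /h -[k.+2]add1n modnDr.
by move/(differ_at_uniq hl0) <-; rewrite odd_k; case: odd.
Qed.

End InducedC4Free.

Lemma SPG_collection_of_cliques (H : sgraph) :
    is_free (cycle_graph 4) H -> is_SPG H ->
  collection_of_cliques H /\
  forall k, odd k -> 5 <= k -> is_free (cycle_graph k) H.
Proof.
move=> C4_free [G [a [b [_ [f [f_bij f_adj]]]]]].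
split; last exact: SPG_odd_hole_free f_bij f_adj C4_free.
split; first exact: SPG_claw_free f_bij f_adj C4_free.
apply: diamond_free_maximal_cliques.
exact: SPG_diamond_free f_bij f_adj C4_free.
Qed.

(** * Two-colourings *)

Section OddCycle.

Variables (T : finType) (e : rel T).

(** A closed walk splits at a repeated vertex into two shorter closed walks. Their lengths have an
    odd sum, so one of them is odd. *)
Lemma odd_cycle_uniq (s : seq T) :
    cycle e s -> odd (size s) ->
  exists t, [/\ cycle e t, odd (size t) & uniq t].
Proof.
have [n] := ubnP (size s); elim: n s => // n IHn s; rewrite ltnS => le_sn cs os.
have [us|] := boolP (uniq s); first by exists s.
case: s => // x0 s in le_sn cs os *; set s' := x0 :: s in le_sn cs os *.
case/(uniqPn x0)=> i [j [lt_ij lt_js eij]].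
have lt_is := ltn_trans lt_ij lt_js; pose x := nth x0 s' i.
(* Rotating puts the repeated vertex [x] first; [p] is then cut at another occurrence of [x]. *)
pose p := drop i.+1 s' ++ take i s'.
have rot_s : rot i s' = x :: p by rewrite /rot (drop_nth x0 lt_is).
have xp : x \in p.
  rewrite mem_cat /x eij -[j](subnKC lt_ij) -nth_drop mem_nth //.
  by rewrite size_drop ltn_sub2r // (leq_ltn_trans _ lt_js).
have := cs; have := os; have := le_sn.
rewrite -(rot_cycle i) -(size_rot i s') rot_s {rot_s}.
case/splitPr: xp => p1 p2; rewrite /= size_cat /= rcons_cat cat_path /=.
move=> le_p odd_p /and3P[xp1 p1x xp2].
have [odd1|even1] := boolP (odd (size p1).+1).
  apply: (IHn (x :: p1)) => //; last by rewrite /= rcons_path xp1.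
  by apply: leq_trans le_p; rewrite ltnS addnS ltnS leq_addr.
apply: (IHn (x :: p2)) => //.
  by apply: leq_trans le_p; rewrite ltnS leq_addl.
by move: odd_p even1; rewrite /= oddD /=; case: odd; case: odd.
Qed.

Hypothesis e_sym : symmetric e.

Lemma two_colourable :
    (forall s, cycle e s -> ~~ odd (size s)) ->
  exists c : T -> bool, forall x y, e x y -> c x != c y.
Proof.
move=> even_cycle.
(* This is the bipartite double cover: each step follows an edge and changes sheet. *)
pose D (u v : T * bool) := e u.1 v.1 && (u.2 != v.2).
have D_sym : connect_sym D.
  by apply: sym_connect_sym => u v; rewrite /D e_sym eq_sym.
have e_csym : connect_sym e by apply: sym_connect_sym.
have lift x y b : connect e x y -> exists b', connect D (x, b) (y, b').
  case/connectP=> p; elim: p x b => [|z p IHp] x b /= => [_ ->|].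
    by exists b.
  case/andP=> exz zp yp; have [b' zy] := IHp z (~~ b) zp yp.
  exists b'; apply: connect_trans zy; apply: connect1.
  by rewrite /D /= exz; case: b.
have walk_parity p u : path D u p ->
    path e u.1 (map fst p) /\ (last u p).2 = u.2 (+) odd (size p).
  elim: p u => [|v p IHp] u /=; first by rewrite addbF.
  case/andP=> /andP[-> uv] /IHp[-> ->]; split=> //.
  by move: uv; case: u.2; case: v.2; case: odd.
have one_sheet x : ~~ connect D (x, true) (x, false).
  apply/negP=> /connectP[p /walk_parity[]]; case/lastP: p => // p [y c] /= ep.
  rewrite last_rcons => ec [exy ecf]; subst y c; move: ep ec.
  rewrite map_rcons size_rcons /= => ep /esym.
  by have := even_cycle (x :: map fst p) ep; rewrite /= size_map; case: odd.
(* The colour of [x] tells whether the root of its component reaches [x] by a walk of even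
   length. *)
pose c x := connect D (root e x, true) (x, true); exists c => x y exy.
have rxy : root e x = root e y by apply/eqP; rewrite root_connect // connect1.
rewrite /c -rxy.
have dxy b : connect D (x, b) (y, ~~ b).
  by apply: connect1; rewrite /D /= exy; case: b.
have [rx|nrx] := boolP (connect D (_, _) (x, true)).
  rewrite eq_sym eqb_id; apply: contra (one_sheet y) => ry.
  by rewrite D_sym in ry; apply: connect_trans ry (connect_trans rx (dxy true)).
(* A walk from the root to [x] lifts to one that starts on sheet [true]; here it can only end on
   sheet [false]. *)
have /(lift _ _ true)[[] rx] : connect e (root e x) x.
- by rewrite e_csym connect_root.
- by rewrite rx in nrx.
by rewrite (connect_trans rx (dxy false)).
Qed.

End OddCycle.

(** * Collections of cliques *)

Section CollectionOfCliques.

Variable H : sgraph.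
Hypothesis H_cliques : collection_of_cliques H.

Lemma clique_sub_maximal (A : {set H}) :
  clique A -> exists2 M, maximal_clique M & A \subset M.
Proof. by case/maxset_exists=> M; exists M. Qed.

(** The guard [y != z] admits the degenerate case [y = z], which is that of an edge. *)
Lemma triangle_sub_maximal (x y z : H) :
    adj x y -> adj x z -> (y != z -> adj y z) ->
  exists M, [/\ maximal_clique M, x \in M, y \in M & z \in M].
Proof.
move=> xy xz yz.
have /clique_sub_maximal[M mM /subsetP sM] : clique [set x; y; z].
  apply/cliqueP=> u v; rewrite !inE -!orbA.
  move=> /or3P[] /eqP-> /or3P[] /eqP->; rewrite ?eqxx // adj_sym // eq_sym.
  exact: yz.
by exists M; rewrite !sM ?inE ?eqxx ?orbT.
Qed.

Lemma edge_sub_maximal (x y : H) :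
  adj x y -> exists M, [/\ maximal_clique M, x \in M & y \in M].
Proof.
move=> xy; have [|M [mM Mx My _]] := triangle_sub_maximal xy xy.
  by rewrite eqxx.
by exists M.
Qed.

Lemma maximal_clique_edge (A B : {set H}) x y :
    maximal_clique A -> maximal_clique B ->
    x \in A -> x \in B -> y \in A -> y \in B -> x != y ->
  A = B.
Proof.
move=> mA mB xA xB yA yB nxy; apply/eqP/negPn/negP=> /eqP nAB.
have := H_cliques.2 A B mA mB nAB; rewrite leqNgt => /negP; apply.
by apply/card_gt1P; exists x, y; rewrite !inE xA xB yA yB.
Qed.

(** With three distinct maximal cliques through [x], one vertex of each lying outside the other two
    would form a claw centred at [x]. *)
Lemma maximal_clique_vertex (A B C : {set H}) x :
    maximal_clique A -> maximal_clique B -> maximal_clique C ->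
    x \in A -> x \in B -> x \in C -> A <> B ->
  C = A \/ C = B.
Proof.
move=> mA mB mC xA xB xC nAB.
have [->|/eqP nCA] := eqVneq C A; first by left.
have [->|/eqP nCB] := eqVneq C B; first by right.
case: H_cliques.1.
have private X Y Z : maximal_clique X -> maximal_clique Y -> maximal_clique Z ->
    x \in X -> x \in Y -> x \in Z -> X <> Y -> X <> Z ->
    exists y, [/\ y \in X, x != y, y \notin Y & y \notin Z].
  move=> mX mY mZ xX xY xZ nXY nXZ.
  have /subsetPn[y yX yNY] : ~~ (X \subset Y).
    apply/negP=> sXY; case: nXY.
    by have /maxsetP[_ /(_ Y (maxsetp mY) sXY)] := mX.
  have nxy : x != y by apply: contraNneq yNY => <-.
  exists y; split=> //; apply: contra_notN nXZ => yZ.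
  exact: maximal_clique_edge nxy.
have adjx X y : maximal_clique X -> x \in X -> y \in X -> x != y -> adj x y.
  by move=> /maxsetp /cliqueP cX xX yX; apply: cX.
(* If [y] and [z] were adjacent, a maximal clique containing [x], [y] and [z] would share an edge
   with both [X] and [Y], and so equal both. *)
have nadj X Y y z : maximal_clique X -> maximal_clique Y ->
    x \in X -> x \in Y -> y \in X -> z \in Y -> x != y -> x != z ->
    X <> Y -> ~~ adj y z.
  move=> mX mY xX xY yX zY nxy nxz nXY; apply: contra_notN nXY => ayz.
  have [M [mM xM yM zM]] := triangle_sub_maximal (adjx X y mX xX yX nxy)
    (adjx Y z mY xY zY nxz) (fun _ => ayz).
  rewrite (maximal_clique_edge mX mM xX xM yX yM nxy).
  exact: maximal_clique_edge nxz.
have [y [yA nxy yNB yNC]] := private A B C mA mB mC xA xB xC nAB (nesym nCA).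
have [z [zB nxz zNA zNC]] :=
  private B A C mB mA mC xB xA xC (nesym nAB) (nesym nCB).
have [t [tC nxt tNA tNB]] := private C A B mC mA mB xC xA xB nCA nCB.
apply: (@claw_induced _ x y z t).
- exact: (adjx A).
- exact: (adjx B).
- exact: (adjx C).
- by move=> yz; rewrite yz zB in yNB.
- by move=> yt; rewrite yt tC in yNC.
- by move=> zt; rewrite zt tC in zNC.
- exact: (nadj A B).
- exact: (nadj A C y t mA mC xA xC yA tC nxy nxt (nesym nCA)).
- exact: (nadj B C z t mB mC xB xC zB tC nxz nxt (nesym nCB)).
Qed.

Lemma ordS_ordS_neq k (i : 'I_k) : 2 < k -> ordS (ordS i) != i.
Proof.
case: k i => // k i gt_k2; rewrite -val_eqE /= -[(_ %% _).+1]addn1 modnDml.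
rewrite addn1 -addn2 -{2}(modn_small (ltn_ord i)) -{2}[val i]addn0 eqn_modDl.
by rewrite mod0n modn_small.
Qed.

(* Vertices chosen in the successive intersections of a ring of cliques have no
   chords, even when the ring has some. *)
Lemma clique_ring k (Q : 'I_k -> {set H}) :
    2 < k -> injective Q -> (forall i, maximal_clique (Q i)) ->
    (forall i, Q i :&: Q (ordS i) != set0) ->
  exists x : 'I_k -> H, [/\ injective x,
    forall i M, maximal_clique M -> x i \in M -> M = Q i \/ M = Q (ordS i)
    & forall i j, adj (x i) (x j) = cycle_rel i j].
Proof.
move=> gt_k2 Q_inj mQ Q_meet.
have ordS_inj : injective (@ordS k) by apply: can_inj (@ordSK k).
have ordS_neq (i : 'I_k) : ordS i <> i.
  by move=> iS; have := ordS_ordS_neq i gt_k2; rewrite !iS eqxx.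
have /fin_all_exists[x /all_and2[xQ xQS]] i :
    exists y, y \in Q i /\ y \in Q (ordS i).
  by have /set0Pn[y] := Q_meet i; rewrite inE => /andP[]; exists y.
have x2 i M : maximal_clique M -> x i \in M -> M = Q i \/ M = Q (ordS i).
  move=> mM xM; apply: (maximal_clique_vertex (mQ i) (mQ (ordS i)) mM) => //.
  by move/Q_inj/esym/ordS_neq.
(* If [x i = x j] with [i] and [j] distinct, then each index is the successor of the other, which
   [2 < k] excludes. *)
have x_inj : injective x.
  move=> i j xij.
  have [||/Q_inj//|/Q_inj ij] := x2 j (Q i); rewrite -?xij //.
  have [||/Q_inj ji|/Q_inj/ordS_inj//] := x2 j (Q (ordS i)); rewrite -?xij //.
  by have := ordS_ordS_neq j gt_k2; rewrite -ij ji eqxx.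
exists x; split=> // i j; rewrite /cycle_rel.
have [<-|nij] := eqVneq i j; first by rewrite adj_irr.
have nx : x i != x j by apply: contraNneq nij => /x_inj->.
apply/idP/orP=> [xij|[/eqP jS|/eqP iS]].
(* The edge lies in a maximal clique [M], which must be one of the two ring cliques at each of its
   ends. *)
- have [M [mM xi xj]] := edge_sub_maximal xij.
  have [Mi|Mi] := x2 i M mM xi; have [Mj|Mj] := x2 j M mM xj;
    move: Mj; rewrite Mi.
  + by move/Q_inj=> ij; rewrite ij eqxx in nij.
  + by move/Q_inj->; rewrite eqxx; right.
  + by move/Q_inj->; rewrite eqxx; left.
  + by move/Q_inj/ordS_inj=> ij; rewrite ij eqxx in nij.
- have /cliqueP := maxsetp (mQ j); apply=> //; first by rewrite jS.
- have /cliqueP := maxsetp (mQ i); apply=> //; by rewrite iS.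
Qed.

Definition clique_meet : rel {set H} := fun A B =>
  [&& maximal_clique A, maximal_clique B, A != B & A :&: B != set0].

Lemma clique_meet_sym : symmetric clique_meet.
Proof. by move=> A B; rewrite /clique_meet eq_sym setIC andbCA. Qed.

Hypothesis H_holes : forall k, odd k -> 5 <= k -> is_free (cycle_graph k) H.

(** An odd ring of distinct cliques yields an induced cycle of the same length through
    [clique_ring]: an odd hole, or a triangle when the length is 3. *)
Lemma clique_meet_even_cycle s : cycle clique_meet s -> ~~ odd (size s).
Proof.
move=> cs; apply/negP => /(odd_cycle_uniq cs)[{cs}s [cs odd_s us]].
case: s => // A p in cs odd_s us *; set s := A :: p in odd_s us *.
set k := size s in odd_s.
pose Q (i : 'I_k) := nth A s i.
have Q_inj : injective Q.
  by move=> i j /eqP; rewrite nth_uniq // => /eqP/val_inj.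
have Q_meet i : clique_meet (Q i) (Q (ordS i)).
  have /(pathP A)/(_ (val i)) := cs; rewrite size_rcons => /(_ (ltn_ord i)).
  rewrite -rcons_cons -/s !nth_rcons ltn_ord.
  have [lti|gei eqi|gti] := ltngtP i (size p).
  - by rewrite /Q /= modn_small.
  - by have := leq_ltn_trans gei (ltn_ord i); rewrite ltnn.
  - by rewrite /Q /= gti modnn.
have mQ i : maximal_clique (Q i) by case/and4P: (Q_meet i).
have QI i : Q i :&: Q (ordS i) != set0 by case/and4P: (Q_meet i).
have gt_k2 : 2 < k.
  move: cs odd_s; rewrite /k /s; case: (p) => [|B [|C r]] //=.
  by rewrite /clique_meet eqxx !andbF.
have [x [x_inj x2 x_adj]] := clique_ring gt_k2 Q_inj mQ QI.
have [gt_k4|] := ltnP 4 k; first by case: (H_holes odd_s gt_k4); exists x.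
move=> le_k4; have k3 : k = 3.
  by move: gt_k2 le_k4 odd_s; case: (k) => [|[|[|[|[|]]]]].
clearbody k; subst k.
pose i0 : 'I_3 := ord0; pose i1 := ordS i0; pose i2 := ordS i1.
have i20 : ordS i2 = i0 by apply: val_inj.
have [||_|M [mM x0 x1 x2']] := @triangle_sub_maximal (x i0) (x i1) (x i2);
  rewrite ?x_adj //.
(* The index of [M] would lie in each of {0, 1}, {1, 2} and {2, 0}, whose intersection is empty. *)
have [M0|M0] := x2 _ M mM x0; have [M1|M1] := x2 _ M mM x1;
  have [M2|M2] := x2 _ M mM x2'; move: M0 M1 M2 => -> /Q_inj M1 /Q_inj M2;
  by [have := congr1 val M1 | have := congr1 val M2].
Qed.

Lemma clique_coordinates :
  exists F : bool -> H -> {set H},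
    (forall s x y, x <> y -> F s x = F s y ->
       adj x y /\ F (~~ s) x <> F (~~ s) y) /\
    (forall x y, adj x y -> exists s, F s x = F s y).
Proof.
have [c c_meet] := two_colourable clique_meet_sym clique_meet_even_cycle.
pose P s x Q := [&& maximal_clique Q, c Q == s & x \in Q].
(* At most one maximal clique of colour [s] contains [x], since two would meet. If there is none,
   the default [[set x]] differs from [F s y] for every other [y], because [y] belongs to
   [F s y]. *)
pose F s x := odflt [set x] [pick Q | P s x Q].
have F_mem s x : x \in F s x.
  by rewrite /F; case: pickP => [Q /and3P[]|] //=; rewrite set11.
have F_eq Q x : maximal_clique Q -> x \in Q -> F (c Q) x = Q.
  move=> mQ xQ; rewrite /F.
  case: pickP => [Q' /and3P[mQ' /eqP cQ' xQ']|/(_ Q)] /=.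
    apply/eqP/negPn/negP=> nQ; have /c_meet : clique_meet Q' Q.
      rewrite /clique_meet mQ' mQ nQ; apply/set0Pn.
      by exists x; rewrite inE xQ' xQ.
    by rewrite cQ' eqxx.
  by rewrite /P mQ eqxx xQ.
have F_max s x y : x <> y -> F s x = F s y ->
    maximal_clique (F s x) /\ c (F s x) = s.
  move=> nxy; have := F_mem s y => + exy; rewrite -exy /F.
  case: pickP => [Q /and3P[mQ /eqP cQ _]|_] //=.
  by rewrite inE => /eqP yx; case: nxy.
exists F; split=> [s x y nxy exy|x y /edge_sub_maximal[M [mM xM yM]]];
  last first.
  by exists (c M); rewrite !F_eq.
have [mF cF] := F_max s x y nxy exy; split.
  have /cliqueP := maxsetp mF; apply; rewrite ?F_mem //; last exact/eqP.
  by rewrite exy F_mem.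
move=> exy'; have [mF' cF'] := F_max _ x y nxy exy'.
(* Two maximal cliques that share both [x] and [y] coincide, but these two have different
   colours. *)
have : F s x = F (~~ s) x.
  apply: (maximal_clique_edge mF mF' (x := x) (y := y)); rewrite ?F_mem //.
  - by rewrite exy F_mem.
  - by rewrite exy' F_mem.
  - exact/eqP.
by move/(congr1 c); rewrite cF cF'; case: (s).
Qed.

End CollectionOfCliques.

(** * Geodesics with two index levels *)

Section TwoLevels.

Variables (H : sgraph) (T : finType) (F : bool -> H -> T).

(* [(false, None)] and [(true, None)] are the two ends, [(false, Some _)] and
   [(true, Some _)] the first and second index levels. *)
Definition two_level_rel : rel (bool * option T) := fun u v =>
  if u.1 == v.1 then isSome u.2 != isSome v.2
  else [exists x, (u.2 == Some (F u.1 x)) && (v.2 == Some (F v.1 x))].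

Lemma two_level_rel_sym : symmetric two_level_rel.
Proof.
move=> u v; rewrite /two_level_rel [v.1 == _]eq_sym [isSome v.2 == _]eq_sym.
by case: ifP => // _; apply: eq_existsb => x; rewrite andbC.
Qed.

Lemma two_level_rel_irr : irreflexive two_level_rel.
Proof. by move=> u; rewrite /two_level_rel !eqxx. Qed.

Definition two_level_graph : sgraph :=
  SGraph two_level_rel_sym two_level_rel_irr.

Local Notation a := ((false, None) : two_level_graph).
Local Notation b := ((true, None) : two_level_graph).

Definition two_level_walk (x : H) : seq two_level_graph :=
  [:: a; (false, Some (F false x)); (true, Some (F true x)); b].

Lemma walk_two_level_walk x : walk a b (two_level_walk x).
Proof.
rewrite /= /two_level_rel /= !andbT; apply/existsP.
by exists x; rewrite !eqxx.
Qed.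

(** The boolean component has to change along the walk, and an edge that changes it is witnessed by
    a vertex of [H]. *)
Lemma walk_nonempty s : walk a b s -> 0 < #|H|.
Proof.
case: s => // u p /= /and3P[/eqP-> pb].
have: (last (a : two_level_graph) p).1 != (a : two_level_graph).1.
  by rewrite (eqP pb).
elim: p {pb u} (a : two_level_graph) => [|v p IHp] u /=; first by rewrite eqxx.
move=> nuv /andP[]; rewrite {1}/two_level_rel; case: eqP => [uv _|_].
  by apply: IHp; rewrite -uv.
by case/existsP=> x _ _; apply/card_gt0P; exists x.
Qed.

Lemma two_level_end s (v : two_level_graph) :
  adj ((s, None) : two_level_graph) v -> exists t, v = (s, Some t).
Proof.
case: v => s' o; rewrite /= /two_level_rel /=; case: eqP => [<-|_].
  by case: o => // t _; exists t.
by case/existsP.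
Qed.

(** The bound also covers sizes below 4, where no walk exists; this yields the minimality of the
    two-level walks as well as their being the only geodesics. *)
Lemma short_walk s :
  walk a b s -> size s <= 4 -> exists x, s = two_level_walk x.
Proof.
case: s => // u p /and3P[/eqP->].
case: p => [/eqP//|v1 p] /= pb /andP[/two_level_end[t1 ev1]]; subst v1.
case: p pb => [/eqP//|v2 p] /= pb /andP[v12].
case: p pb => [|v3 p] /=.
  move=> /eqP v2b; rewrite v2b two_level_rel_sym in v12.
  by case/two_level_end: v12.
case: p => //= /eqP-> /andP[+ _] _; rewrite two_level_rel_sym.
case/two_level_end=> t2 ev2; subst v2.
by case/existsP: v12 => x /= /andP[/eqP[->] /eqP[->]]; exists x.
Qed.

Lemma two_level_geodesicP s :
  reflect (exists x, s = two_level_walk x) (geodesic a b s).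
Proof.
apply: (iffP idP) => [gs|[x ->]].
  have /card_gt0P[x _] := walk_nonempty (geodesic_walk gs).
  apply: short_walk (geodesic_walk gs) _.
  exact: (geodesic_leq_walk gs (walk_two_level_walk x)).
apply/geodesicP; split=> [|t /is_path_walk wt].
  by rewrite is_pathE walk_two_level_walk.
rewrite leqNgt; apply/negP=> lt_t4.
have [y ty] := short_walk wt (ltnW lt_t4).
by rewrite ty in lt_t4.
Qed.

Hypothesis F_adj : forall x y : H, adj x y <->
  exists s, F s x = F s y /\ F (~~ s) x <> F (~~ s) y.
Hypothesis F_inj : forall x y : H, (forall s, F s x = F s y) -> x = y.

Lemma two_level_isomorphic : isomorphic H (shortest_path_graph a b).
Proof.
have gx x : geodesic a b (two_level_walk x).
  by apply/two_level_geodesicP; exists x.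
pose f x : shortest_path_graph a b :=
  exist (fun s : #|two_level_graph|.-bseq two_level_graph => geodesic a b s)
    (Bseq (size_is_path (geodesicP _ _ _ (gx x)).1)) (gx x).
have f_coord x : coord (f x) =1 nth a (two_level_walk x) by [].
have f_inj : injective f.
  move=> x y fxy; apply: F_inj => s.
  have := f_coord x (if s then 2 else 1); rewrite fxy f_coord.
  by case: s => -[].
have /fin_all_exists[g fK] : forall y, exists x, f x = y.
  move=> y; have /two_level_geodesicP[x yx] := valP y.
  by exists x; do 2!apply: val_inj.
exists f; split; first by exists g => // x; apply: f_inj.
move=> x y; apply/idP/idP.
  case/shortest_path_adjP=> i [nxy xy].
  (* Index 1 carries [F false] and index 2 carries [F true]; a difference at index 1 means that the
     [F true] values agree. *)
  apply/F_adj; exists (i == 1); move: nxy (xy 1) (xy 2); rewrite !f_coord.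
  case: i {xy} => [|[|[|[|i]]]] //=.
  - by move=> nF _ /(_ isT)[F2]; split=> // F1; rewrite F1 in nF.
  - by move=> nF /(_ isT)[F1] _; split=> // F2; rewrite F2 in nF.
case/F_adj=> s [Fs Fns]; apply/shortest_path_adjP.
exists (if s then 1 else 2); split=> [|j].
  by case: s Fns {Fs} => nF; rewrite !f_coord => -[].
by case: s Fs {Fns}; case: j => [|[|[|[|j]]]] //= Fs _; rewrite !f_coord /= ?Fs.
Qed.

(** For an empty [H] there is no walk from [a] to [b], and the distance is infinite. *)
Lemma two_level_dist : 0 < #|H| -> dist a b = Some 3.
Proof.
case/card_gt0P=> x _; apply/distP.
by exists (two_level_walk x) => //; apply/two_level_geodesicP; exists x.
Qed.

End TwoLevels.

(** * Realization of collections of cliques, and the equivalence *)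

Lemma SPG_of_collection_of_cliques (H : sgraph) :
    collection_of_cliques H ->
    (forall k, odd k -> 5 <= k -> is_free (cycle_graph k) H) ->
  exists (G : sgraph) (a b : G),
    [/\ a != b, isomorphic H (shortest_path_graph a b)
      & 0 < #|H| -> dist a b = Some 3].
Proof.
move=> H_cl H_holes; have [F [F_eq F_adj]] := clique_coordinates H_cl H_holes.
exists (two_level_graph F), (false, None), (true, None); split=> //.
  apply: two_level_isomorphic => x y => [|Fxy].
    split=> [xy|[s [Fs Fns]]].
      have [s Fs] := F_adj x y xy; exists s; split=> //.
      have nxy : x <> y by move=> exy; rewrite exy adj_irr in xy.
      by have [] := F_eq s x y nxy Fs.
    have nxy : x <> y by move=> exy; rewrite exy in Fns.
    by have [] := F_eq s x y nxy Fs.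
  (* Distinct vertices that agree at one level differ at the other, so both coordinates together
     determine the vertex. *)
  by apply/eqP/negPn/negP=> /eqP nxy; have [_] := F_eq true x y nxy (Fxy true).
exact: two_level_dist.
Qed.

Unset Implicit Arguments.

Theorem theorem22 (H : sgraph) (hC4 : is_free (cycle_graph 4) H) :
  (is_SPG H <->
     collection_of_cliques H /\
     (forall k : nat, odd k -> 5 <= k -> is_free (cycle_graph k) H)) /\
  (is_SPG H -> 0 < #|H| ->
     exists (G : sgraph) (a b : G),
       dist a b = Some 3 /\ isomorphic (shortest_path_graph a b) H).
Proof.
split; first split.
- exact: SPG_collection_of_cliques.
- case=> H_cl H_holes.
  have [G [a [b [nab iso _]]]] := SPG_of_collection_of_cliques H_cl H_holes.
  by exists G, a, b.
case/(SPG_collection_of_cliques hC4)=> H_cl H_holes H_gt0.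
have [G [a [b [_ iso d3]]]] := SPG_of_collection_of_cliques H_cl H_holes.
by exists G, a, b; split; [exact: d3 | exact: isomorphic_sym].
Qed.
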